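(* Let $D\subset\mathbb{R}^N$ be a hyperinterval and let $f(x)=(f_1(x),\dots,f_r(x))$, $r\ge 1$, be a vector function over $D$. Every partition made by using the second traditional partition strategy (as described in the context) leads to creation of one or two sub-cells having $f(x)$ evaluated at two vertices.
   Context: A hyperinterval (also called interval, box, or cell) in $\mathbb{R}^N$ is a set $[a,b]=\{x\in\mathbb{R}^N : a\le x\le b\}$, the inequalities being componentwise; its vertices are the points $x$ with $x_j\in\{a_j,b_j\}$ for every $j=1,\dots,N$. Second traditional partition strategy (used in one-point-based algorithms, which adaptively subdivide $D$ into smaller hyperintervals and use one point for the description of $f$ over each of them): an internal point is chosen within the region $D$, $f$ is evaluated at this point, and $D$ is subdivided into $2^N$ sub-boxes (sub-cells) by the $N$ hyperplanes orthogonal to the coordinate axes and passing through this point. Then one of the existing sub-boxes is chosen for the next subdivision and is partitioned in the same way: $f$ is evaluated at an internal point of the chosen box, and the box is replaced by the $2^N$ sub-boxes obtained by cutting it by the hyperplanes orthogonal to the coordinate axes and passing through that point. The process is then repeated. Each such subdivision is called a partition. The information obtained by evaluating $f$ at a point is used by the $2^N$ sub-boxes that the subdivision at this point creates, the point being a vertex of each of them. A sub-cell has $f$ evaluated at a vertex if that vertex is one of the points at which $f$ has been evaluated.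
   Formalization: The claim is proved for every partition after the initial subdivision of D (with N ≥ 1); the initial one is excluded because there each sub-cell has f evaluated at only one vertex, so no sub-cell has it evaluated at two. *)

(* Defs.v *)
From mathcomp Require Import all_boot all_order all_algebra.
From mathcomp Require Import reals.

Set Implicit Arguments.
Unset Strict Implicit.
Unset Printing Implicit Defensive.

Import Order.TTheory GRing.Theory Num.Theory.
Local Open Scope ring_scope.

(* The pair (a, b) represents the hyperinterval
   [a, b] = {x | a_j <= x_j <= b_j for all j}. *)
Definition box (R : realType) (N : nat) : Type := ('rV[R]_N * 'rV[R]_N)%type.

Definition vertex (R : realType) (N : nat) (c : box R N) (x : 'rV[R]_N) : bool :=
  [forall j, (x 0 j == c.1 0 j) || (x 0 j == c.2 0 j)].

Definition internal (R : realType) (N : nat) (c : box R N) (p : 'rV[R]_N) : bool :=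
  [forall j, c.1 0 j < p 0 j < c.2 0 j].

(* The N hyperplanes x_j = p_j cut a box into orthants around p; the orthant s
   lies above the j-th hyperplane when s j is true and below it otherwise. *)
Definition subcell (R : realType) (N : nat) (c : box R N) (p : 'rV[R]_N)
    (s : {ffun 'I_N -> bool}) : box R N :=
  (\row_j (if s j then p 0 j else c.1 0 j),
   \row_j (if s j then c.2 0 j else p 0 j)).

Definition subcells (R : realType) (N : nat) (c : box R N) (p : 'rV[R]_N) :
    seq (box R N) :=
  [seq subcell c p s | s : {ffun 'I_N -> bool}].

Lemma size_subcells (R : realType) (N : nat) (c : box R N) (p : 'rV[R]_N) :
  size (subcells c p) = (2 ^ N)%N.
Proof. by rewrite size_map -cardE card_ffun card_bool card_ord. Qed.

Lemma uniq_subcells (R : realType) (N : nat) (c : box R N) (p : 'rV[R]_N) :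
  internal c p -> uniq (subcells c p).
Proof.
move=> /forallP pin; rewrite map_inj_uniq ?enum_uniq // => s t [/rowP est _].
apply/ffunP => j; have /andP[ap _] := pin j; have := est j; rewrite !mxE.
by case: (s j); case: (t j) => // e; move: ap; rewrite e ltxx.
Qed.

(* [cells] is the current subdivision of the initial box; [trials] records the
   evaluations made so far, as pairs (x, f x). *)
Record state (R : realType) (N r : nat) := State {
  cells : seq (box R N);
  trials : seq ('rV[R]_N * 'rV[R]_r)
}.

Definition subdivide (R : realType) (N r : nat) (f : 'rV[R]_N -> 'rV[R]_r)
    (S : state R N r) (c : box R N) (p : 'rV[R]_N) : state R N r :=
  State (subcells c p ++ rem c (cells S)) ((p, f p) :: trials S).

(* The states reachable from D: the choices of the box to be partitioned and of
   the internal point are unconstrained, hence may depend adaptively on the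
   trials.  Before the initial subdivision of D nothing has been evaluated, so
   its sub-cells have a single evaluated vertex; it is the starting point, and
   the partitions are the subdivisions of existing sub-boxes that follow. *)
Inductive second_strategy (R : realType) (N r : nat)
    (f : 'rV[R]_N -> 'rV[R]_r) (D : box R N) : state R N r -> Prop :=
| second_strategy_init (p : 'rV[R]_N) :
    internal D p ->
    second_strategy f D (subdivide f (State [:: D] [::]) D p)
| second_strategy_next (S : state R N r) (c : box R N) (p : 'rV[R]_N) :
    second_strategy f D S -> c \in cells S -> internal c p ->
    second_strategy f D (subdivide f S c p).

(* The [undup] makes this the number of distinct vertices of c at which f has
   been evaluated. *)
Definition evaluated_vertices (R : realType) (N r : nat) (S : state R N r)
    (c : box R N) : nat :=
  count (vertex c) (undup [seq t.1 | t <- trials S]).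

(* Main.v *)
Require Import Defs.
From mathcomp Require Import all_boot all_order all_algebra.
From mathcomp Require Import reals.

(** The proposition rests on the following invariant: throughout the process,
    an evaluated point that belongs to a (closed) cell is one of its vertices
    ([tidy]).  It is preserved because the new point [p] is interior to the
    box [c] being cut: [p] is a vertex of all the sub-cells of [c], no earlier
    point of [c] lies on a cutting hyperplane since such points are vertices
    of [c], and [p] avoids every other cell, each being on the far side of
    some hyperplane bounding [c].

    Consequently a sub-cell of [c] has exactly two candidates for an evaluated
    vertex: [p], which is always evaluated and is new, and the one corner that
    it shares with [c], opposite to [p] ([evaluated_vertices_subcell]).  Every
    cell thus has one or two evaluated vertices ([evaluated_vertices_1or2]):
    cutting [c] leaves the other cells unchanged in this respect, and one or
    two is exactly what the sub-cells of [c] receive.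

    Finally, sub-cells of [c] correspond bijectively to corners of [c], so the
    sub-cells with two evaluated vertices are as many as the evaluated vertices
    of [c] itself before the cut: one or two. *)

Set Implicit Arguments.
Unset Strict Implicit.
Unset Printing Implicit Defensive.

Import Order.TTheory GRing.Theory Num.Theory.
Local Open Scope ring_scope.

Lemma pairwise_rem (T : eqType) (r : rel T) (x : T) (s : seq T) :
  pairwise r s -> pairwise r (rem x s).
Proof. by have /subseqP[m _ ->] := rem_subseq x s; apply: pairwise_mask. Qed.

Lemma all_pairwise_rem (T : eqType) (r : rel T) (x : T) (s : seq T) :
  symmetric r -> x \in s -> pairwise r s -> all (r x) (rem x s).
Proof.
move=> rC; elim: s => //= y s IHs; rewrite inE => xs /andP[ry rs].
case: (eqVneq y x) xs => [<- //|_ /= xs].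
by rewrite IHs // rC (allP ry).
Qed.

(** * Geometry of boxes and of their sub-cells *)

Section Boxes.
Variables (R : realType) (N : nat).
Implicit Types (c e : box R N) (p x : 'rV[R]_N) (s : {ffun 'I_N -> bool}).

Definition inside c x : bool := [forall j, c.1 0 j <= x 0 j <= c.2 0 j].

Definition nonempty c : bool := [forall j, c.1 0 j <= c.2 0 j].

(** A hyperplane orthogonal to an axis puts the two boxes on opposite sides;
    this form of disjointness of interiors passes at once to sub-boxes. *)
Definition separated c e : bool :=
  [exists j, (c.2 0 j <= e.1 0 j) || (e.2 0 j <= c.1 0 j)].

Definition corner c s : 'rV[R]_N := \row_j (if s j then c.2 0 j else c.1 0 j).

Lemma internal_inside c p : internal c p -> inside c p.
Proof.
by move=> /forallP pc; apply/forallP => j; have /andP[/ltW-> /ltW->] := pc j.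
Qed.

Lemma internal_nonempty c p : internal c p -> nonempty c.
Proof.
move=> /forallP pc; apply/forallP => j; have /andP[/ltW ap /ltW pb] := pc j.
exact: le_trans pb.
Qed.

Lemma internal_vertexN c p : (0 < N)%N -> internal c p -> ~~ vertex c p.
Proof.
move=> N_gt0 /forallP pc; rewrite negb_forall; apply/existsP.
exists (Ordinal N_gt0); have /andP[ap pb] := pc (Ordinal N_gt0).
by rewrite negb_or (gt_eqF ap) (lt_eqF pb).
Qed.

Lemma vertex_inside c x : nonempty c -> vertex c x -> inside c x.
Proof.
move=> /forallP c0 /forallP cx; apply/forallP => j.
by have /orP[] := cx j => /eqP->; rewrite c0 lexx.
Qed.

Lemma separatedC : symmetric separated.
Proof. by move=> c e; apply: eq_existsb => j; rewrite orbC. Qed.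

Lemma separated_outside c e p :
  internal c p -> separated c e -> ~~ inside e p.
Proof.
move=> /forallP pc /existsP[j sep]; apply: contraL sep => /forallP/(_ j).
have /andP[ap pb] := pc j; case/andP=> ep pe; rewrite negb_or -!ltNge.
by rewrite (le_lt_trans ep pb) (lt_le_trans ap pe).
Qed.

Lemma subcell_nonempty c p s : internal c p -> nonempty (subcell c p s).
Proof.
move=> /forallP pc; apply/forallP => j; have /andP[/ltW ap /ltW pb] := pc j.
by rewrite !mxE; case: (s j).
Qed.

Lemma subcell_inside c p s x :
  internal c p -> inside (subcell c p s) x -> inside c x.
Proof.
move=> /forallP pc /forallP sx; apply/forallP => j.
have /andP[/ltW ap /ltW pb] := pc j; have := sx j; rewrite !mxE.
case: (s j) => /andP[lx xu]; first by rewrite xu (le_trans ap).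
by rewrite lx (le_trans xu).
Qed.

Lemma subcell_separated c e p s :
  internal c p -> separated c e -> separated (subcell c p s) e.
Proof.
move=> /forallP pc /existsP[j sep]; apply/existsP; exists j.
have /andP[/ltW ap /ltW pb] := pc j; rewrite !mxE.
case/orP: sep => [be|ea]; case: (s j).
- by rewrite be.
- by rewrite (le_trans pb be).
- by rewrite (le_trans ea ap) orbT.
- by rewrite ea orbT.
Qed.

Lemma subcells_separated c p : pairwise separated (subcells c p).
Proof.
rewrite /subcells pairwise_map.
have := enum_uniq {ffun 'I_N -> bool}; rewrite uniq_pairwise.
apply: sub_pairwise => s t /= neq_st.
have /existsP[j neq_j] : [exists j, s j != t j].
  apply: contraR neq_st => /existsPn eq_st.
  by apply/eqP/ffunP => j; apply/eqP; have := eq_st j; rewrite negbK.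
apply/existsP; exists j; rewrite !mxE.
by case: (s j) neq_j; case: (t j); rewrite //= lexx ?orbT.
Qed.

Lemma vertex_subcell_pivot c p s : vertex (subcell c p s) p.
Proof. by apply/forallP => j; rewrite !mxE; case: (s j); rewrite eqxx ?orbT. Qed.

(** A cutting hyperplane goes through no vertex of [c], so a vertex of [c] in
    the closed orthant [s] is the corner in the direction [s]. *)
Lemma inside_subcell_corner c p s x : internal c p ->
  vertex c x -> inside (subcell c p s) x -> x = corner c s.
Proof.
move=> /forallP pc /forallP cx /forallP sx; apply/rowP => j.
have /andP[ap pb] := pc j; have := sx j; rewrite !mxE.
have /orP[/eqP->|/eqP->] := cx j; case: (s j) => // /andP[].
  by rewrite leNgt ap.
by rewrite [p 0 j < _]ltNge in pb => _ bp; rewrite bp in pb.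
Qed.

Lemma vertex_corner c s : vertex c (corner c s).
Proof. by apply/forallP => j; rewrite !mxE; case: (s j); rewrite eqxx ?orbT. Qed.

Lemma vertex_subcell_corner c p s : vertex (subcell c p s) (corner c s).
Proof. by apply/forallP => j; rewrite !mxE; case: (s j); rewrite eqxx ?orbT. Qed.

Lemma corner_inj c p : internal c p -> injective (corner c).
Proof.
move=> /forallP pc s t /rowP eq_st; apply/ffunP => j.
have /andP[ap pb] := pc j; have := lt_trans ap pb; have := eq_st j.
by rewrite !mxE; case: (s j); case: (t j) => // ->; rewrite ltxx.
Qed.

Lemma vertexP c x : vertex c x -> exists s, x = corner c s.
Proof.
move=> /forallP cx; exists [ffun j => x 0 j == c.2 0 j]; apply/rowP => j.
rewrite !mxE ffunE; have /orP[] := cx j => /eqP->; last by rewrite eqxx.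
by case: eqP.
Qed.

Lemma count_corners c p (T : seq 'rV[R]_N) : internal c p -> uniq T ->
  count (fun s => corner c s \in T) (enum {ffun 'I_N -> bool}) =
  count (vertex c) T.
Proof.
move=> pc uT; rewrite -(count_map (corner c) (mem T)) -!size_filter.
apply/perm_size/uniq_perm; rewrite ?filter_uniq //.
  by rewrite map_inj_uniq ?enum_uniq //; apply: corner_inj pc.
move=> x; rewrite !mem_filter /= andbC; congr (_ && _).
apply/mapP/idP => [[s _ ->]|/vertexP[s ->]]; first exact: vertex_corner.
by exists s; rewrite ?mem_enum.
Qed.

End Boxes.

(** * Evaluated vertices along the process *)

Section Process.
Variables (R : realType) (N r : nat) (f : 'rV[R]_N -> 'rV[R]_r).
Implicit Types (S : state R N r) (c e D : box R N) (p : 'rV[R]_N).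

Definition points S : seq 'rV[R]_N := [seq t.1 | t <- trials S].

(** Separation of the cells is what keeps a later point, interior to one cell,
    out of the others; nonemptiness makes the vertices of a cell belong to it,
    so that being out of a cell excludes being a vertex of it. *)
Record tidy S : Prop := Tidy {
  tidy_nonempty : {in cells S, forall c, nonempty c};
  tidy_separated : pairwise (@separated R N) (cells S);
  tidy_vertex :
    {in cells S & points S, forall c x, inside c x -> vertex c x}
}.

Lemma tidy_start D p : internal D p -> tidy (State [:: D] [::]).
Proof.
move=> pD; split => //= c; rewrite inE => /eqP->.
exact: internal_nonempty pD.
Qed.

Lemma rem_separated S c e :
  tidy S -> c \in cells S -> e \in rem c (cells S) -> separated c e.
Proof.
move=> [_ sepS _] cS; apply/allP.
exact: all_pairwise_rem (@separatedC R N) cS sepS.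
Qed.

Lemma tidy_subdivide S c p :
  tidy S -> c \in cells S -> internal c p -> tidy (subdivide f S c p).
Proof.
move=> tS cS pc; have [neS sepS vertS] := tS; split => /=.
- move=> e; rewrite mem_cat => /orP[/mapP[s _ ->]|/mem_rem/neS //].
  exact: subcell_nonempty.
- rewrite pairwise_cat subcells_separated pairwise_rem // !andbT.
  apply/allrelP => _ e /mapP[s _ ->] eS.
  exact: subcell_separated (rem_separated tS cS eS).
move=> e x; rewrite mem_cat inE => /orP[/mapP[s _ ->]|eS].
  case/predU1P=> [-> _|xS sx]; first exact: vertex_subcell_pivot.
  have cx := vertS _ _ cS xS (subcell_inside pc sx).
  by rewrite (inside_subcell_corner pc cx sx) vertex_subcell_corner.
case/predU1P=> [->|xS]; last exact: vertS (mem_rem eS) xS.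
by rewrite (negPf (separated_outside pc (rem_separated tS cS eS))).
Qed.

Lemma evaluated_vertices_rem S c e p :
  tidy S -> c \in cells S -> internal c p -> e \in rem c (cells S) ->
  evaluated_vertices (subdivide f S c p) e = evaluated_vertices S e.
Proof.
move=> tS cS pc eS; rewrite /evaluated_vertices /=.
suff /negPf nep : ~~ vertex e p by case: ifP => //= _; rewrite nep.
apply: contra (separated_outside pc (rem_separated tS cS eS)).
exact: vertex_inside (tidy_nonempty tS (mem_rem eS)).
Qed.

(** The summand [1] is the cutting point; among the earlier points only the
    corner of [c] opposite to it can be a vertex of the sub-cell. *)
Lemma evaluated_vertices_subcell S c p s : (0 < N)%N ->
  tidy S -> c \in cells S -> internal c p ->
  evaluated_vertices (subdivide f S c p) (subcell c p s) =
  (1 + (corner c s \in points S))%N.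
Proof.
move=> N_gt0 tS cS pc; rewrite /evaluated_vertices /= -/(points S).
have -> : (p \in points S) = false.
  apply: contraNF (internal_vertexN N_gt0 pc) => pS.
  exact: tidy_vertex tS _ _ cS pS (internal_inside pc).
rewrite /= vertex_subcell_pivot -mem_undup -count_uniq_mem ?undup_uniq //.
congr (1 + _)%N; apply: eq_in_count => x; rewrite mem_undup => xS /=.
apply/idP/eqP => [sx|->]; last exact: vertex_subcell_corner.
have insx := vertex_inside (subcell_nonempty s pc) sx.
apply: (inside_subcell_corner pc _ insx).
exact: tidy_vertex tS _ _ cS xS (subcell_inside pc insx).
Qed.

Lemma second_strategy_tidy D S : second_strategy f D S -> tidy S.
Proof.
elim=> {S} [p pD|S c p _ tS cS pc]; last exact: tidy_subdivide.
by apply: tidy_subdivide (tidy_start pD) _ pD; rewrite inE.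
Qed.

Lemma evaluated_vertices_1or2 D S c : (0 < N)%N ->
  second_strategy f D S -> c \in cells S ->
  evaluated_vertices S c = 1%N \/ evaluated_vertices S c = 2%N.
Proof.
move=> N_gt0 stratS; elim: stratS c => {S} [p pD|S e p stratS IHS eS pe] c.
  rewrite /= eqxx cats0 => /mapP[s _ ->]; left.
  by rewrite (evaluated_vertices_subcell s N_gt0 (tidy_start pD)) ?inE.
have tS := second_strategy_tidy stratS.
rewrite mem_cat => /orP[/mapP[s _ ->]|cS].
  rewrite (evaluated_vertices_subcell s N_gt0 tS eS pe).
  by case: (_ \in _); [right | left].
by rewrite (evaluated_vertices_rem tS eS pe cS); apply: IHS (mem_rem cS).
Qed.

Lemma count_two_evaluated S c p : (0 < N)%N ->
  tidy S -> c \in cells S -> internal c p ->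
  count (fun e => evaluated_vertices (subdivide f S c p) e == 2%N)
        (subcells c p) = evaluated_vertices S c.
Proof.
move=> N_gt0 tS cS pc; rewrite count_map.
rewrite [RHS]/evaluated_vertices -/(points S).
rewrite -(count_corners pc (undup_uniq _)); apply: eq_count => s /=.
rewrite (evaluated_vertices_subcell s N_gt0 tS cS pc) mem_undup.
by case: (_ \in _).
Qed.

End Process.

Theorem proposition1p1 (R : realType) (N r : nat) (f : 'rV[R]_N -> 'rV[R]_r)
    (D : box R N) (S : state R N r) (c : box R N) (p : 'rV[R]_N) :
  (1 <= N)%N -> (1 <= r)%N ->
  second_strategy f D S -> c \in cells S -> internal c p ->
  let k := count (fun s : box R N =>
                    evaluated_vertices (subdivide f S c p) s == 2%N)
                 (subcells c p) in
  k = 1%N \/ k = 2%N.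
Proof.
move=> N_gt0 _ stratS cS pc /=.
rewrite (count_two_evaluated f N_gt0 (second_strategy_tidy stratS) cS pc).
exact: evaluated_vertices_1or2 N_gt0 stratS cS.
Qed.
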